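(* Let $(R,pR)$ be a discrete valuation domain with valuation $\mathsf{v}$ and $q=|R/pR|<\infty$. Let $f\in R[x]$ be a non-constant primitive polynomial with irreducible divisor set $\mathcal{P}$, $f=\prod_{g\in\mathcal{P}}g^{m_g}$ with $m_g\in\mathbb{N}$, and $n:=\mathsf{v}(\operatorname{d}(f))\in\mathbb{N}$ (so $n\ge1$); set $F=\frac{f}{p^n}$. Let $W\subseteq\mathcal{W}(f)$ be finite such that the matrix $A\in\mathbb{Q}^{W\times\mathcal{P}}$ whose row indexed by $w\in W$ is $\mathsf{v}_{\mathcal{P}}(w)$ has $\mathbb{Q}$-linearly independent rows and satisfies $\ker(A)=\operatorname{fdk}(f)$, and let $u$ be the number of rows of $A$ with exactly one non-zero entry. Assume $F$ is irreducible in $\operatorname{Int}(R)$. Then the following are equivalent: (1) $F$ is absolutely irreducible in $\operatorname{Int}(R)$; (2) $F^S$ factors uniquely in $\operatorname{Int}(R)$ for $S=2(n+1)\,n^{q^{\lceil n/2\rceil}}$; (3) $F^S$ factors uniquely in $\operatorname{Int}(R)$ for $S=2(n+1)\,n^{\operatorname{rank}(A)-u}$.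
   Context: $(R,pR)$ is a discrete valuation domain with valuation $\mathsf{v}$, finite residue field, and quotient field $K$. $\operatorname{Int}(R)=\{F\in K[x]\mid F(R)\subseteq R\}$. For $f\in R[x]$, $\operatorname{d}(f)=\gcd(f(a)\mid a\in R)$, so $\mathsf{v}(\operatorname{d}(f))=\min_{a\in R}\mathsf{v}(f(a))$. Primitive means the coefficients generate $R$. An irreducible divisor set $\mathcal{P}$ of $f$ is a set of representatives of the associate classes of irreducible divisors of $f$ in $R[x]$. For $a\in R$, $\mathsf{v}_{\mathcal{P}}(a)=(\mathsf{v}(g(a)))_{g\in\mathcal{P}}$. $\mathcal{W}(f)=\{a\in R\mid \mathsf{v}(f(a))=\mathsf{v}(\operatorname{d}(f))\}$, and $$\operatorname{fdk}(f)=\Big\{(u_g)_{g\in\mathcal{P}}\in\mathbb{Q}^{\mathcal{P}}\ \Big|\ \forall a\in\mathcal{W}(f):\ \textstyle\sum_{g\in\mathcal{P}}u_g\,\mathsf{v}(g(a))=0\Big\}.$$ An element ''factors uniquely'' if all its factorizations into irreducibles are essentially the same (same number of factors, pairwise associated after reindexing). An irreducible $r$ is absolutely irreducible if $r^k$ factors uniquely (as $r\cdots r$) for every $k\in\mathbb{N}$. *)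

(* Defs.v *)
From HB Require Import structures.
From mathcomp Require Import all_boot all_order fingroup perm all_algebra.
From mathcomp Require Import fraction.
Set Implicit Arguments. Unset Strict Implicit. Unset Printing Implicit Defensive.
Import Order.TTheory GRing.Theory Num.Theory.
Local Open Scope ring_scope.

Definition dvdr {T : comUnitRingType} (a b : T) := exists c : T, b = a * c.
Definition assocr {T : comUnitRingType} (a b : T) :=
  exists2 e : T, e \is a GRing.unit & a = e * b.
Definition irr_el {T : comUnitRingType} (a : T) :=
  [/\ a != 0, a \isn't a GRing.unit &
      forall b c : T, a = b * c -> b \is a GRing.unit \/ c \is a GRing.unit].

Section DVR.
Variable R : idomainType.

(* (R, pR) is a DVR with normalized valuation v: p is a nonzero nonunit and
   every nonzero a is (unit) * p^(v a).  (v 0 is irrelevant.) *)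
Definition is_dvr (p : R) (v : R -> nat) :=
  [/\ p != 0, p \isn't a GRing.unit &
      forall a : R, a != 0 -> exists2 e : R, e \is a GRing.unit & a = e * p ^+ v a].

Definition residue_card (p : R) (q : nat) :=
  exists s : seq R,
    [/\ size s = q,
        forall a : R, exists2 b, b \in s & dvdr p (a - b) &
        forall i j, (i < size s)%N -> (j < size s)%N ->
          dvdr p (s`_i - s`_j) -> i = j].

Definition primitive_poly (f : {poly R}) :=
  exists h : nat -> R, \sum_(i < size f) h i * f`_i = 1.

(* n = v(d(f)) = min_{a in R} v(f(a))  (v(0) = infinity) *)
Definition vd (v : R -> nat) (f : {poly R}) (n : nat) :=
  (exists a : R, f.[a] != 0 /\ v f.[a] = n) /\
  (forall a : R, f.[a] != 0 -> (n <= v f.[a])%N).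

Definition inWf (v : R -> nat) (f : {poly R}) (n : nat) (a : R) :=
  f.[a] != 0 /\ v f.[a] = n.

Definition irr_divisor_set (f : {poly R}) (k : nat) (P : 'I_k -> {poly R}) :=
  [/\ forall j, irr_el (P j) /\ dvdr (P j) f,
      forall i j, i != j -> ~ assocr (P i) (P j) &
      forall g : {poly R}, irr_el g -> dvdr g f -> exists j, assocr g (P j)].

Definition valmat (v : R -> nat) (k l : nat) (P : 'I_k -> {poly R})
  (W : 'I_l -> R) : 'M[rat]_(l, k) :=
  \matrix_(i, j) ((v (P j).[W i])%:R : rat).

Definition fdk (v : R -> nat) (f : {poly R}) (n : nat) (k : nat)
  (P : 'I_k -> {poly R}) (x : 'cV[rat]_k) :=
  forall a : R, inWf v f n a -> \sum_(j < k) x j 0 * (v (P j).[a])%:R = 0.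

Definition single_rows (l k : nat) (A : 'M[rat]_(l, k)) : nat :=
  #|[set i : 'I_l | #|[set j : 'I_k | A i j != 0]| == 1%N]|.

Definition inInt (F : {poly {fraction R}}) :=
  forall a : R, exists b : R, F.[tofrac a] = tofrac b.

Definition Int_unit (F : {poly {fraction R}}) :=
  [/\ inInt F, F \is a GRing.unit & inInt F^-1].

Definition Int_irr (F : {poly {fraction R}}) :=
  [/\ inInt F, F != 0, ~ Int_unit F &
      forall G H, inInt G -> inInt H -> F = G * H -> Int_unit G \/ Int_unit H].

Definition Int_assoc (F G : {poly {fraction R}}) :=
  exists2 e, Int_unit e & F = e * G.

Definition Int_factorization (F : {poly {fraction R}}) (s : seq {poly {fraction R}}) :=
  (forall h, h \in s -> Int_irr h) /\ F = \prod_(h <- s) h.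

Definition Int_factors_uniquely (F : {poly {fraction R}}) :=
  forall s t, Int_factorization F s -> Int_factorization F t ->
    size s = size t /\
    exists sigma : 'S_(size s),
      forall i : 'I_(size s), Int_assoc s`_i t`_(sigma i).

Definition Int_abs_irr (F : {poly {fraction R}}) :=
  Int_irr F /\ forall j : nat, (0 < j)%N -> Int_factors_uniquely (F ^+ j).

Definition Fpoly (p : R) (n : nat) (f : {poly R}) : {poly {fraction R}} :=
  (tofrac p ^+ n)^-1 *: map_poly (@tofrac R) f.

End DVR.

(* Main.v *)
Require Import Defs.
From Stdlib Require Import Classical_Prop.
From HB Require Import structures.
From mathcomp Require Import all_boot all_order fingroup perm all_algebra.
From mathcomp Require Import generic_quotient fraction zify ring.
Set Implicit Arguments. Unset Strict Implicit. Unset Printing Implicit Defensive.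
Import Order.TTheory GRing.Theory Num.Theory.
Local Open Scope ring_scope.

(* Write K for the fraction field.  By Gauss's lemma the P_j are irreducible and
   pairwise coprime in K[x], so every factor of F^t in Int(R) is, up to a unit,
   prod_j P_j^(a_j) / p^E; it takes unit values on W(f), that is,
   sum_j a_j v(P_j(w)) = E for all w in W(f).

   If fdk(f) = 0, this forces n a = E m, and irreducibility of F leaves only
   the powers of F, so F is absolutely irreducible.

   If fdk(f) <> 0, then A has fewer rows than columns.  The rows of
   A diag(m) are nonnegative with sum n, so the pigeonhole principle gives a
   nonzero integral y with A diag(m) y = 0 and |y_j| <= B = n^(rank A - u).
   Then F^(2(n+1)B) splits as a product of two non-powers of F.

   Finally rank A <= q^(ceil(n/2)): the row of w in W(f) depends only on w modulo
   p^(ceil(n/2)), as its weighted sum n leaves room for at most one entry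
   exceeding ceil(n/2). *)

(** * Combinatorics of nonnegative integer rows with a fixed sum *)

(* A row in U has at most one nonzero entry; setting the corresponding
   coordinate of y to zero satisfies it, at the cost of one unknown. *)
Lemma siegel_pigeonhole (l k n : nat) (M : 'I_l -> 'I_k -> nat)
    (U : {set 'I_l}) (c : 'I_l -> 'I_k) :
  (0 < n)%N -> (l < k)%N -> (forall i, \sum_j M i j = n)%N ->
  (forall i j, i \in U -> j != c i -> M i j = 0)%N ->
  exists y1 y2 : 'I_k -> nat,
    [/\ (forall j, y1 j <= n ^ (l - #|U|))%N,
        (forall j, y2 j <= n ^ (l - #|U|))%N,
        exists j, y1 j != y2 j &
        forall i, (\sum_j M i j * y1 j = \sum_j M i j * y2 j)%N].
Proof.
move=> n0 lk Msum MU.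
set B := (n ^ (l - #|U|))%N; set r := (l - #|U|)%N.
pose C := c @: U.
have leCU : (#|C| <= #|U|)%N by apply: leq_imset_card.
have cardU : (#|U| <= l)%N by rewrite -[X in (_ <= X)%N]card_ord max_card.
(* Unknowns are indexed outside [C] only; the coordinates in [C] default to zero. *)
pose ext (y : {ffun {j | j \notin C} -> 'I_B.+1}) (j : 'I_k) : nat :=
  oapp (fun x => nat_of_ord (y x)) 0%N (insub j).
have ext_le y j : (ext y j <= B)%N.
  by rewrite /ext; case: insubP => //= x _ _; rewrite -ltnS.
have sum_lt y i : (\sum_j M i j * ext y j < (n * B).+1)%N.
  rewrite ltnS -(Msum i) big_distrl /=; apply: leq_sum => j _.
  by rewrite leq_mul2l ext_le orbT.
pose T (y : {ffun {j | j \notin C} -> 'I_B.+1}) :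
    {ffun {i | i \notin U} -> 'I_(n * B).+1} :=
  [ffun i => Ordinal (sum_lt y (val i))].
(* There are [r] equations and, since [#|C| <= #|U|] and [l < k], at least [r + 1] unknowns. With
   [B = n ^ r], (nB+1)^r <= (n(B+1))^r = B (B+1)^r < (B+1)^(r+1). *)
have cardlt : (#|{ffun {i | i \notin U} -> 'I_(n * B).+1}| <
               #|{ffun {j | j \notin C} -> 'I_B.+1}|)%N.
  rewrite !card_ffun !card_sig !card_ord.
  have -> : #|[predC U]| = r by have := cardC U; rewrite card_ord /r; lia.
  have hC : (r.+1 <= #|[predC C]|)%N.
    have := cardC C; rewrite card_ord /r; lia.
  apply: (@leq_trans (B.+1 ^ r.+1)); last by rewrite leq_pexp2l.
  apply: (@leq_ltn_trans ((n * B.+1) ^ r)).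
    case: (r) => [|r1]; first by rewrite !expn0.
    by rewrite leq_exp2r //; lia.
  by rewrite expnMn expnS ltn_pmul2r ?expn_gt0 //.
have /injectivePn [y1 [y2 y12 Ty]] : ~~ injectiveb T.
  by apply/injectiveP => /leq_card; rewrite leqNgt cardlt.
exists (ext y1), (ext y2); split=> //.
- apply/existsP; apply: contraNT y12; rewrite negb_exists => /forallP h.
  apply/eqP/ffunP => x; apply: val_inj; have := h (val x).
  by rewrite negbK /ext valK /= => /eqP.
move=> i; have [iU|iU] := boolP (i \in U).
  rewrite !big1 // => j _.
    have [->|/MU->//] := eqVneq j (c i).
    rewrite /ext insubN ?muln0 // negbK; exact: imset_f.
  have [->|/MU->//] := eqVneq j (c i).
  rewrite /ext insubN ?muln0 // negbK; exact: imset_f.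
by have /ffunP/(_ (exist _ i iU)) := Ty; rewrite !ffunE => /(congr1 val).
Qed.

(** If two capped entries agree while the entries differ, the larger one exceeds [h]. As [n <= 2h],
    all other entries of that vector lie below [h], so the caps determine them, and the weighted
    sums cannot both be [n]. *)
Lemma capped_eq_of_weighted_sum_eq (k h n : nat) (m x x' : 'I_k -> nat) :
  (n <= h.*2)%N -> (forall j, 0 < m j)%N ->
  (\sum_j m j * x j = n)%N -> (\sum_j m j * x' j = n)%N ->
  (forall j, minn (x j) h = minn (x' j) h) -> x =1 x'.
Proof.
move=> nh m0.
suff le (y y' : 'I_k -> nat) : (\sum_j m j * y j = n)%N ->
    (\sum_j m j * y' j = n)%N -> (forall j, minn (y j) h = minn (y' j) h) ->
    forall j, (y' j <= y j)%N.
  move=> sx sx' mxx' j; apply/eqP; rewrite eqn_leq.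
  by rewrite (le x') // (le x).
move=> sy sy' myy' j; rewrite leqNgt; apply/negP => lt.
have h1 := myy' j; have hj : (h < y' j)%N by lia.
have hother i : i != j -> y i = y' i.
  move=> ij; have := myy' i; suff : (y' i < h)%N by lia.
  move: sy'; rewrite (bigD1 j) //= (bigD1 i) //=.
  by have := m0 i; have := m0 j; nia.
move: sy'; rewrite -sy (bigD1 j) //= [RHS](bigD1 j) //=.
rewrite [X in (_ + X = _)%N](eq_bigr (fun i => m i * y i)%N); last first.
  by move=> i ij; rewrite hother.
by have := m0 j; nia.
Qed.

Lemma fraction_tofrac_div (R : idomainType) (x : {fraction R}) :
  exists a b : R, b != 0 /\ x = tofrac a / tofrac b.
Proof.
exists (\n_(repr x)), (\d_(repr x)).
have d0 : \d_(repr x) != 0 by apply: denom_ratioP.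
split=> //.
apply: (canRL (mulfK _)); first by rewrite tofrac_eq0.
rewrite -{1}[x]reprK; case: (repr x) d0 => -[a b] /= h _.
rewrite /tofrac; unlock FracField.tofrac.
rewrite -[LHS]FracField.pi_mul.
apply/eqP; rewrite FracField.equivf_def /= /FracField.mulf /=.
by rewrite !numden_Ratio ?mulf_neq0 ?oner_eq0 //= ?mulr1 //; apply/eqP; ring.
Qed.

(** * Valuations, and residues modulo powers of p *)

Section DiscreteValuation.
Variables (R : idomainType) (p : R) (v : R -> nat).
Hypothesis hdvr : is_dvr p v.

Lemma dvr_neq0 : p != 0. Proof. by case: hdvr. Qed.
Lemma dvr_nonunit : p \isn't a GRing.unit. Proof. by case: hdvr. Qed.
Lemma dvr_val a : a != 0 ->
  exists2 e : R, e \is a GRing.unit & a = e * p ^+ v a.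
Proof. by case: hdvr => _ _; apply. Qed.

Lemma tofrac_p_neq0 i : tofrac p ^+ i != 0.
Proof. by rewrite expf_neq0 // tofrac_eq0 dvr_neq0. Qed.

Lemma unitX_eq_leq (e e' : R) i j : e \is a GRing.unit -> e' \is a GRing.unit ->
  e * p ^+ i = e' * p ^+ j -> (i <= j)%N.
Proof.
move=> ue ue' E; rewrite leqNgt; apply/negP => ji.
move: E; rewrite -(subnKC ji) addSnnS exprD mulrA [e * _]mulrC -mulrA [LHS]mulrC.
move/(mulIf (expf_neq0 _ dvr_neq0)) => E.
have : e * p ^+ (i - j.+1).+1 \is a GRing.unit by rewrite E.
by rewrite unitrM ue exprS unitrM (negPf dvr_nonunit).
Qed.

Lemma unitX_inj (e e' : R) i j : e \is a GRing.unit -> e' \is a GRing.unit ->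
  e * p ^+ i = e' * p ^+ j -> i = j.
Proof.
move=> ue ue' E; apply/eqP; rewrite eqn_leq (unitX_eq_leq ue ue' E).
exact: (unitX_eq_leq ue' ue (esym E)).
Qed.

Lemma val_unitX e i : e \is a GRing.unit -> v (e * p ^+ i) = i.
Proof.
move=> ue; have : e * p ^+ i != 0.
  by rewrite mulf_neq0 ?expf_neq0 ?dvr_neq0 //; apply: contraTneq ue => ->; rewrite unitr0.
case/dvr_val => e' ue' E; exact: esym (unitX_inj ue ue' E).
Qed.

Lemma val1 : v 1 = 0%N.
Proof. by have := @val_unitX 1 0 (unitr1 _); rewrite expr0 mulr1. Qed.

Lemma valM a b : a != 0 -> b != 0 -> v (a * b) = (v a + v b)%N.
Proof.
move=> a0 b0; have [e ue Ea] := dvr_val a0; have [e' ue' Eb] := dvr_val b0.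
rewrite {1}Ea {1}Eb mulrACA -exprD val_unitX // unitrM ue ue' //.
Qed.

Lemma val_prodX k (x : 'I_k -> R) (a : 'I_k -> nat) :
  (forall j, x j != 0) -> v (\prod_j x j ^+ a j) = (\sum_j a j * v (x j))%N.
Proof.
(* Nonvanishing is carried through the induction because [valM] requires it. *)
move=> x0; suff [] : \prod_j x j ^+ a j != 0 /\
  v (\prod_j x j ^+ a j) = (\sum_j a j * v (x j))%N by [].
elim/big_ind2 : _ => [|y s z t [y0 <-] [z0 <-]|j _].
- by rewrite oner_eq0 val1.
- by rewrite mulf_neq0 // valM.
rewrite expf_neq0 //; split=> //; elim: (a j) => [|i IH]; first by rewrite val1.
by rewrite exprS valM ?expf_neq0 // IH mulSn.
Qed.

Lemma unit_val a : a != 0 -> (a \is a GRing.unit) = (v a == 0%N).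
Proof.
move=> /dvr_val [e ue E]; rewrite {1}E unitrM ue /=.
by case: (v a) => [|i]; rewrite ?expr0 ?unitr1 // exprS unitrM (negPf dvr_nonunit).
Qed.

Lemma dvdr_valP i a : a != 0 -> dvdr (p ^+ i) a <-> (i <= v a)%N.
Proof.
move=> a0; have [e ue E] := dvr_val a0; split=> [[c Ec]|le].
  have c0 : c != 0 by apply: contraNneq a0 => c0; rewrite Ec c0 mulr0.
  rewrite Ec valM ?expf_neq0 ?dvr_neq0 //.
  by have := @val_unitX 1 i (unitr1 _); rewrite mul1r => ->; rewrite leq_addr.
by exists (e * p ^+ (v a - i)); rewrite mulrCA -exprD subnKC.
Qed.

Lemma nonunit_dvdr a : a \isn't a GRing.unit <-> dvdr p a.
Proof.
have [->|a0] := eqVneq a 0.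
  by split=> [_|_]; [exists 0; rewrite mulr0 | rewrite unitr0].
rewrite unit_val // -lt0n -[p in dvdr p]expr1; split=> h; exact/(dvdr_valP 1 a0).
Qed.

Lemma dvdrD (c a b : R) : dvdr c a -> dvdr c b -> dvdr c (a + b).
Proof. by move=> [x ->] [y ->]; exists (x + y); rewrite mulrDr. Qed.

Lemma dvdr_mull (c a b : R) : dvdr c b -> dvdr c (a * b).
Proof. by move=> [x ->]; exists (a * x); rewrite mulrCA. Qed.

Lemma dvdr_mulr (c a b : R) : dvdr c a -> dvdr c (a * b).
Proof. by move=> [x ->]; exists (x * b); rewrite mulrA. Qed.

Lemma dvdr_opp (c a : R) : dvdr c a -> dvdr c (- a).
Proof. by move=> [x ->]; exists (- x); rewrite mulrN. Qed.

Lemma dvdr_sum (c : R) I (r : seq I) (Q : pred I) (g : I -> R) :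
  (forall i, Q i -> dvdr c (g i)) -> dvdr c (\sum_(i <- r | Q i) g i).
Proof.
move=> h; apply: big_ind => //; last exact: dvdrD.
by exists 0; rewrite mulr0.
Qed.

(** A fraction is a unit times an integral power of p; the two exponents [i] and [j] avoid negative
    ones. *)
Lemma frac_unitX (x : {fraction R}) : x != 0 ->
  exists e i j, e \is a GRing.unit /\ x * tofrac p ^+ j = tofrac e * tofrac p ^+ i.
Proof.
have [a [b [b0 ->]]] := fraction_tofrac_div x.
rewrite mulf_eq0 negb_or tofrac_eq0 => /andP[a0 _].
have [e ue Ea] := dvr_val a0; have [e' ue' Eb] := dvr_val b0.
exists (e / e'), (v a), (v b); split; first by rewrite unitrM ue unitrV.
rewrite {1}Ea {1}Eb !rmorphM !rmorphXn /= rmorphV //=.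
have : tofrac e' != 0 :> {fraction R}.
  by rewrite tofrac_eq0; apply: contraTneq ue' => ->; rewrite unitr0.
move=> e'0; have pb0 := tofrac_p_neq0 (v b).
by rewrite invfM mulrA mulfVK // mulrAC.
Qed.

(** Representatives are built digit by digit: [c] is the digit of p^h added to a representative [b]
    modulo p^h. *)
Lemma residue_mod_pX (q : nat) : residue_card p q -> forall h : nat,
  exists s : seq R, (size s <= q ^ h)%N /\
    forall a, exists2 b, b \in s & dvdr (p ^+ h) (a - b).
Proof.
move=> [s0 [<- cov _]]; elim=> [|h [s [sz hs]]].
  exists [:: 0]; split=> // a; exists 0; rewrite ?inE //.
  by exists (a - 0); rewrite expr0 mul1r.
exists [seq b + p ^+ h * c | b <- s, c <- s0]; split.
  by rewrite size_allpairs expnS mulnC leq_mul.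
move=> a; have [b bs [d Ed]] := hs a; have [c cs [d' Ed']] := cov d.
exists (b + p ^+ h * c); first exact: allpairs_f.
exists d'; rewrite opprD addrA Ed exprSr -mulrA -Ed'; ring.
Qed.

Lemma horner_dvdr_sub (g : {poly R}) (c a b : R) :
  dvdr c (a - b) -> dvdr c (g.[a] - g.[b]).
Proof.
move=> cab; elim/poly_ind: g => [|g d IH].
  by rewrite !horner0 subrr; exists 0; rewrite mulr0.
rewrite !hornerMXaddC.
have -> : g.[a] * a + d - (g.[b] * b + d) = (g.[a] - g.[b]) * a + g.[b] * (a - b).
  by ring.
by apply: dvdrD; [apply: dvdr_mulr | apply: dvdr_mull].
Qed.

(** The power of p with exponent min(v(x), h) divides both x and x - y, hence y; the situation is
    symmetric. *)
Lemma minn_val_congr h (a b : R) : a != 0 -> b != 0 -> dvdr (p ^+ h) (a - b) ->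
  minn (v a) h = minn (v b) h.
Proof.
suff le x y : x != 0 -> y != 0 -> dvdr (p ^+ h) (x - y) -> (minn (v x) h <= v y)%N.
  move=> a0 b0 ab; apply/eqP; rewrite eqn_leq !leq_min !geq_minr !andbT le //=.
  by apply: le => //; rewrite -opprB; apply: dvdr_opp.
move=> x0 y0 xy; apply/(dvdr_valP _ y0).
have -> : y = x - (x - y) by ring.
apply: dvdrD; first by apply/dvdr_valP => //; rewrite geq_minl.
apply: dvdr_opp; case: xy => d ->; exists (p ^+ (h - minn (v x) h) * d).
by rewrite mulrA -exprD subnKC ?geq_minr.
Qed.

(** * Gauss's lemma over the valuation ring *)

(** Primitivity in the form adapted to a local ring, where elements generate the unit ideal only if
    one of them is a unit. *)
Definition has_unit_coef (g : {poly R}) := exists i, g`_i \is a GRing.unit.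

Lemma not_has_unit_coef g : ~ has_unit_coef g -> exists g', g = p *: g'.
Proof.
move=> ng; have h i : dvdr p g`_i.
  by apply/nonunit_dvdr/negP => u; apply: ng; exists i.
elim/poly_ind: g h {ng} => [|g c IH] h; first by exists 0; rewrite scaler0.
have [g' ->] : exists g', g = p *: g'.
  by apply: IH => i; have := h i.+1; rewrite coefD coefMX coefC /= addr0.
have [c' ->] : dvdr p c by have := h 0%N; rewrite coefD coefMX coefC /= add0r.
by exists (g' * 'X + c'%:P); rewrite scalerDr scalerAl -!mul_polyC polyCM.
Qed.

(* Gauss: at the sum of the least indices of unit coefficients exactly one
   summand of the convolution is a unit. *)
Lemma has_unit_coefM g h :
  has_unit_coef g -> has_unit_coef h -> has_unit_coef (g * h).
Proof.
move=> gu hu; have [i gi imin] := ex_minnP gu; have [j hj jmin] := ex_minnP hu.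
exists (i + j)%N; rewrite coefM.
have lti : (i < (i + j).+1)%N by rewrite ltnS leq_addr.
rewrite (bigD1 (Ordinal lti)) //= addKn.
apply/negPn/negP => /nonunit_dvdr d.
have d' : dvdr p (\sum_(k < (i + j).+1 | k != Ordinal lti) g`_k * h`_(i + j - k)).
  apply: dvdr_sum => k; rewrite -val_eqE /= => ki.
  case: (ltngtP k i) ki => // ki _.
    by apply/dvdr_mulr/nonunit_dvdr/negP => /imin; rewrite leqNgt ki.
  by apply/dvdr_mull/nonunit_dvdr/negP => /jmin; have := ltn_ord k; lia.
have := dvdrD d (dvdr_opp d'); rewrite addrK => /nonunit_dvdr.
by rewrite unitrM gi hj.
Qed.

Local Notation mapF := (map_poly (@tofrac R)).

Lemma tofrac_inj : injective (@tofrac R).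
Proof. by move=> x y /eqP; rewrite tofrac_eq => /eqP. Qed.

Lemma mapF_inj : injective mapF.
Proof. by apply: map_inj_poly; [exact: tofrac_inj | rewrite rmorph0]. Qed.

Lemma size_mapF g : size (mapF g) = size g.
Proof. by apply: size_map_inj_poly; [exact: tofrac_inj | rewrite rmorph0]. Qed.

Lemma mapF_eq0 g : (mapF g == 0) = (g == 0).
Proof. by rewrite -!size_poly_eq0 size_mapF. Qed.

Lemma unit_content (A : {poly {fraction R}}) : A != 0 ->
  exists c g, [/\ c != 0, has_unit_coef g & A = c *: mapF g].
Proof.
move=> A0.
(* Clear denominators first. *)
have [d [B [d0 AB]]] : exists d B, d != 0 /\ tofrac d *: A = mapF B.
  elim/poly_ind: A {A0} => [|A c [d [B [d0 E]]]].
    by exists 1, 0; rewrite oner_eq0 scaler0 rmorph0.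
  have [a [b [b0 ->]]] := fraction_tofrac_div c.
  exists (b * d), (b *: B * 'X + (d * a)%:P); split; first by rewrite mulf_neq0.
  rewrite rmorphD /= [mapF (_ * 'X)]rmorphM /= map_polyX map_polyC map_polyZ /= -E.
  rewrite scalerDr scalerA !rmorphM /= -scalerAl; congr (_ + _).
  rewrite -mul_polyC -!polyCM; congr (polyC _).
  rewrite [tofrac b * _]mulrC -mulrA [tofrac b * _]mulrC mulfVK //.
  by rewrite tofrac_eq0.
have B0 : B != 0.
  by rewrite -mapF_eq0 -AB scaler_eq0 tofrac_eq0 negb_or d0.
(* Then extract p as long as no coefficient is a unit; each extraction lowers the valuation of the
   leading coefficient by one, so this stops. *)
have [i [g [gu Eg]]] : exists i g, has_unit_coef g /\ B = p ^+ i *: g.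
  move: {2}(v (lead_coef B)) (erefl (v (lead_coef B))) => N.
  elim: N B B0 {AB} => [|N IH] B B0 vB.
    exists 0%N, B; rewrite expr0 scale1r; split=> //; exists (size B).-1.
    by rewrite -/(lead_coef B) unit_val ?lead_coef_eq0 // vB.
  have [Bu|/not_has_unit_coef[B' EB]] := classic (has_unit_coef B).
    by exists 0%N, B; rewrite expr0 scale1r.
  have B'0 : B' != 0 by apply: contraNneq B0 => B'0; rewrite EB B'0 scaler0.
  have [|i [g [gu Eg]]] := IH B' B'0.
    move: vB; rewrite EB lead_coefZ valM ?dvr_neq0 ?lead_coef_eq0 //.
    by have := @val_unitX 1 1 (unitr1 _); rewrite mul1r expr1 => ->; rewrite add1n => -[].
  by exists i.+1, g; split=> //; rewrite EB Eg scalerA exprS.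
exists (tofrac (p ^+ i) / tofrac d), g; split=> //.
  by rewrite mulf_neq0 ?invr_eq0 ?tofrac_eq0 ?expf_neq0 ?dvr_neq0.
rewrite mulrC -scalerA -map_polyZ -Eg -AB scalerA mulVf ?scale1r //.
by rewrite tofrac_eq0.
Qed.

(** Write [c] as a unit times a power of p and clear denominators: a surplus factor p on one side
    would divide a unit coefficient on the other. *)
Lemma unit_coef_scale g h (c : {fraction R}) :
  has_unit_coef g -> has_unit_coef h -> mapF g = c *: mapF h ->
  exists2 e, e \is a GRing.unit & c = tofrac e.
Proof.
move=> gu hu E.
have g0 : g != 0 by case: gu => i; apply: contraTneq => ->; rewrite coef0 unitr0.
have c0 : c != 0.
  by apply: contraNneq g0 => c0; rewrite -mapF_eq0 E c0 scale0r.
have [e [i [j [ue Ec]]]] := frac_unitX c0.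
have E' : p ^+ j *: g = (e * p ^+ i) *: h.
  apply: mapF_inj; rewrite !map_polyZ /= E scalerA mulrC rmorphXn Ec.
  by rewrite rmorphM rmorphXn.
suff ij : i = j.
  exists e => //; apply: (mulIf (tofrac_p_neq0 j)); by rewrite Ec ij.
have nu N : p ^+ N.+1 \isn't a GRing.unit.
  by rewrite exprS unitrM (negPf dvr_nonunit).
case: (ltngtP i j) => // lt.
  case: hu => t ht; have := congr1 (fun r : {poly R} => r`_t) E'.
  rewrite !coefZ -(subnKC lt) addSnnS exprD [e * _]mulrC -!mulrA.
  move/(mulfI (expf_neq0 _ dvr_neq0)) => Et.
  have : e * h`_t \is a GRing.unit by rewrite unitrM ue.
  by rewrite -Et unitrM (negPf (nu _)).
case: gu => t gt; have := congr1 (fun r : {poly R} => r`_t) E'.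
rewrite !coefZ -(subnKC lt) addSnnS exprD [e * _]mulrC -!mulrA.
move/(mulfI (expf_neq0 _ dvr_neq0)) => Et.
by move: gt; rewrite Et unitrM (negPf (nu _)).
Qed.

Lemma irr_el_unit_coef (g : {poly R}) : irr_el g -> (1 < size g)%N -> has_unit_coef g.
Proof.
move=> [g0 _ irr] sz; have [//|/not_has_unit_coef[g' E]] := classic (has_unit_coef g).
have := irr p%:P g'; rewrite mul_polyC => /(_ E) [|].
  by rewrite poly_unitE coefC /= (negPf dvr_nonunit) andbF.
rewrite poly_unitE => /andP[/eqP sg' _].
by move: sz; rewrite E size_scale ?dvr_neq0 // sg'.
Qed.

(** Rescale both factors over the fraction field to have unit coefficients. Their product still has
    one, so the remaining scalar is a unit of [R] and the factorization descends to [R[x]]. *)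
Lemma irr_el_irreducible_frac (g : {poly R}) :
  irr_el g -> (1 < size g)%N -> irreducible_poly (mapF g).
Proof.
move=> irrg sz; have gu := irr_el_unit_coef irrg sz.
have [g0 _ irr] := irrg.
split; first by rewrite size_mapF.
move=> A szA /dvdpP [B E].
have AB0 : B * A != 0 by rewrite -E mapF_eq0.
have A0 : A != 0 by apply: contraNneq AB0 => ->; rewrite mulr0.
have B0 : B != 0 by apply: contraNneq AB0 => ->; rewrite mul0r.
have [a [A1 [a0 A1u EA]]] := unit_content A0.
have [b [B1 [b0 B1u EB]]] := unit_content B0.
have E1 : mapF g = (b * a) *: mapF (B1 * A1).
  by rewrite E EA EB rmorphM /= -scalerAl -scalerAr scalerA.
have [e ue Ee] := unit_coef_scale gu (has_unit_coefM B1u A1u) E1.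
have E2 : g = B1 * (e *: A1).
  by apply: mapF_inj; rewrite E1 Ee -map_polyZ -scalerAr.
have e0 : e != 0 by apply: contraTneq ue => ->; rewrite unitr0.
have [u|u] := irr _ _ E2; move: u; rewrite poly_unitE => /andP[/eqP s1 _].
  have : size B == 1%N by rewrite EB size_scale // size_mapF s1.
  case/size_poly1P => x x0 Ex.
  by rewrite E Ex mul_polyC eqp_sym; apply: eqp_scale.
move: szA; rewrite EA size_scale // size_mapF.
by rewrite -(size_scale A1 e0) s1.
Qed.

(** A nontrivial gcd is associated to both irreducible polynomials; their ratio is then a constant,
    and by [unit_coef_scale] a unit of [R]. *)
Lemma irr_el_coprime_frac (g h : {poly R}) : irr_el g -> irr_el h ->
  (1 < size g)%N -> (1 < size h)%N -> ~ assocr g h -> coprimep (mapF g) (mapF h).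
Proof.
move=> ig ih sg sh nas; have Ig := irr_el_irreducible_frac ig sg.
have Ih := irr_el_irreducible_frac ih sh.
rewrite /coprimep; apply/negPn/negP => ns; apply: nas.
have e1 := Ig _ ns (dvdp_gcdl _ _); have e2 := Ih _ ns (dvdp_gcdr _ _).
have /eqpfP E : mapF g %= mapF h by rewrite -(eqp_ltrans e1).
have [e ue Ee] := unit_coef_scale (irr_el_unit_coef ig sg) (irr_el_unit_coef ih sh) E.
have e0 : e != 0 by apply: contraTneq ue => ->; rewrite unitr0.
exists e%:P; first by rewrite poly_unitE size_polyC coefC e0 ue.
by apply: mapF_inj; rewrite E Ee mul_polyC map_polyZ.
Qed.

End DiscreteValuation.

(** * Divisors of products of pairwise coprime irreducible polynomials over a field *)

Section IrreducibleFamily.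
Variables (K : fieldType) (k : nat) (Q : 'I_k -> {poly K}).
Hypothesis Qirr : forall j, irreducible_poly (Q j).
Hypothesis Qcop : forall i j, i != j -> coprimep (Q i) (Q j).

(** Induction on the list: its head either divides [G] and is cancelled, or is coprime to [G] and is
    dropped. *)
Lemma dvdp_prod_irred (G : {poly K}) (s : seq 'I_k) :
  G %| \prod_(j <- s) Q j -> exists a : 'I_k -> nat, G %= \prod_j Q j ^+ a j.
Proof.
elim: s G => [|j s IH] G.
  rewrite big_nil => G1; exists (fun=> 0%N); rewrite big1 => [|i _]; last exact: expr0.
  by rewrite -size_poly_eq1 -dvdp1.
rewrite big_cons; have [/dvdpP[H ->]|ndvd] := boolP (Q j %| G).
  rewrite mulrC dvdp_mul2l ?irredp_neq0 // => /IH [a Ha].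
  exists (fun i => a i + (i == j))%N.
  rewrite (bigD1 j) //= eqxx addn1 exprS -mulrA.
  rewrite (eq_bigr (fun i => Q i ^+ a i)); last first.
    by move=> i /negPf->; rewrite addn0.
  rewrite -(bigD1 j (P := xpredT) (F := fun i => Q i ^+ a i)) //=.
  by rewrite eqp_mul2l ?irredp_neq0.
rewrite Gauss_dvdpr; first exact: IH.
rewrite coprimep_sym /coprimep; apply/negPn/negP => ns.
have e1 := (Qirr j) _ ns (dvdp_gcdl _ _).
by move: ndvd; rewrite -(eqp_dvdl _ e1) dvdp_gcdr.
Qed.

Lemma dvdp_prodX_irred (G : {poly K}) (b : 'I_k -> nat) :
  G %| \prod_j Q j ^+ b j -> exists a : 'I_k -> nat, G %= \prod_j Q j ^+ a j.
Proof.
move=> Gb; apply: (@dvdp_prod_irred _ (flatten [seq nseq (b j) j | j <- index_enum 'I_k])).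
rewrite big_flatten big_map; congr (_ %| _): Gb; apply: eq_bigr => j _.
by rewrite big_nseq iter_mulr_1.
Qed.

Lemma prodX_irred_dvdp_leq (a b : 'I_k -> nat) :
  \prod_j Q j ^+ a j %| \prod_j Q j ^+ b j -> forall j, (a j <= b j)%N.
Proof.
move=> ab j; have : Q j ^+ a j %| \prod_j Q j ^+ b j.
  by apply: dvdp_trans ab; rewrite (bigD1 j) //= dvdp_mulr.
rewrite (bigD1 j) //= Gauss_dvdpl; last first.
  apply: (big_ind (fun x => coprimep _ x)) => [|x y|i ij]; first exact: coprimep1.
    by move=> cx cy; rewrite coprimepMr cx.
  by apply/coprimep_expl/coprimep_expr/Qcop; rewrite eq_sym.
by rewrite dvdp_Pexp2l //; case: (Qirr j).
Qed.

End IrreducibleFamily.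

(** * Units and factorizations in Int(R) *)

Section IntegerValued.
Variables (R : idomainType) (p : R) (v : R -> nat).
Hypothesis hdvr : is_dvr p v.
Local Notation K := {fraction R}.
Local Notation mapF := (map_poly (@tofrac R)).

Lemma horner_Fpoly i g r :
  (Fpoly p i g).[tofrac r] = (tofrac p ^+ i)^-1 * tofrac g.[r].
Proof. by rewrite /Fpoly hornerZ horner_map. Qed.

Lemma FpolyM i j (g h : {poly R}) :
  Fpoly p i g * Fpoly p j h = Fpoly p (i + j) (g * h).
Proof.
by rewrite /Fpoly -scalerAl -scalerAr scalerA -invfM -exprD rmorphM.
Qed.

Lemma FpolyX i (g : {poly R}) t : Fpoly p i g ^+ t = Fpoly p (t * i) (g ^+ t).
Proof.
elim: t => [|t IH]; last by rewrite !exprS IH FpolyM mulSn.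
by rewrite /Fpoly mul0n !expr0 invr1 scale1r rmorph1.
Qed.

Lemma size_Fpoly i (g : {poly R}) : size (Fpoly p i g) = size g.
Proof.
by rewrite /Fpoly size_scale ?size_mapF // invr_eq0 (tofrac_p_neq0 hdvr).
Qed.

Lemma Fpoly_dvdr i (g : {poly R}) r : dvdr (p ^+ i) g.[r] ->
  exists b : R, (Fpoly p i g).[tofrac r] = tofrac b.
Proof.
move=> [d E]; exists d; rewrite horner_Fpoly E rmorphM rmorphXn mulKf //.
exact: tofrac_p_neq0 hdvr _.
Qed.

Lemma inIntM (G H : {poly K}) : inInt G -> inInt H -> inInt (G * H).
Proof.
move=> iG iH r; have [a Ea] := iG r; have [b Eb] := iH r.
by exists (a * b); rewrite hornerM Ea Eb rmorphM.
Qed.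

Lemma inInt1 : inInt (1 : {poly K}).
Proof. by move=> r; exists 1; rewrite hornerC rmorph1. Qed.

Lemma inInt_tofracC (a : R) : inInt (tofrac a)%:P.
Proof. by move=> r; exists a; rewrite hornerC. Qed.

Lemma inIntX (G : {poly K}) t : inInt G -> inInt (G ^+ t).
Proof.
move=> iG; elim: t => [|t IH]; first by rewrite expr0; exact: inInt1.
by rewrite exprS; apply: inIntM.
Qed.

Lemma Int_unit_tofracC (e : R) : e \is a GRing.unit -> Int_unit (tofrac e)%:P.
Proof.
move=> ue; have e0 : e != 0 by apply: contraTneq ue => ->; rewrite unitr0.
split; first exact: inInt_tofracC.
  by rewrite poly_unitE size_polyC coefC unitfE tofrac_eq0 e0.
by rewrite polyCV -rmorphV //; apply: inInt_tofracC.
Qed.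

Lemma Int_unit_size (G : {poly K}) : Int_unit G -> size G = 1%N.
Proof. by case=> _; rewrite poly_unitE => /andP[/eqP]. Qed.

Lemma Int_unitM (G H : {poly K}) : Int_unit G -> Int_unit H -> Int_unit (G * H).
Proof.
move=> [iG uG iG'] [iH uH iH']; split; first exact: inIntM.
  by rewrite unitrM uG.
by rewrite invrM //; apply: inIntM.
Qed.

(** Factors inherit this property within Int(R), by [unit_atM]. It passes from the powers of F, at
    points of W(f), to all their factors. *)
Definition unit_at (w : R) (G : {poly K}) :=
  exists2 e, e \is a GRing.unit & G.[tofrac w] = tofrac e.

Lemma unit_atM w (G H : {poly K}) : inInt G -> inInt H ->
  unit_at w (G * H) -> unit_at w G /\ unit_at w H.
Proof.
move=> /(_ w)[a Ea] /(_ w)[b Eb] [e ue]; rewrite hornerM Ea Eb -rmorphM.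
move=> /tofrac_inj E; move: ue; rewrite -E unitrM => /andP[ua ub].
by split; [exists a | exists b].
Qed.

Lemma unit_at_size1 w (G : {poly K}) : inInt G -> unit_at w G ->
  (size G <= 1)%N -> Int_unit G.
Proof.
move=> iG [e ue E] /size1_polyC Gc.
suff -> : G = (tofrac e)%:P by apply: Int_unit_tofracC.
by rewrite -E [in RHS]Gc hornerC -Gc.
Qed.

(** Induction on the degree: a constant factor equals its value at [w], a unit, so in a splitting
    into nonunits both factors have positive degree. *)
Lemma unit_at_factorization w (G : {poly K}) : inInt G -> unit_at w G ->
  ~ Int_unit G -> exists s, Int_factorization G s.
Proof.
move: {2}(size G).+1 (ltnSn (size G)) => N.
elim: N G => [//|N IH] G sG iG wG nuG.
have G0 : G != 0.
  case: wG => e ue E; apply/eqP => G0; move: E.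
  rewrite G0 horner0 => /esym/eqP; rewrite tofrac_eq0 => /eqP e0.
  by move: ue; rewrite e0 unitr0.
have [irrG|redG] := classic (Int_irr G).
  by exists [:: G]; split; [move=> h; rewrite inE => /eqP-> | rewrite big_seq1].
have [A [B [iA iB [uA uB E]]]] : exists A B,
    [/\ inInt A, inInt B & [/\ ~ Int_unit A, ~ Int_unit B & G = A * B]].
  apply: NNPP => nex; apply: redG; split=> // A B iA iB E.
  apply: NNPP => /not_or_and[uA uB]; apply: nex; exists A, B; split=> //.
have [wA wB] : unit_at w A /\ unit_at w B by apply: unit_atM; rewrite -?E.
have sA : (1 < size A)%N.
  by rewrite ltnNge; apply/negP => /(unit_at_size1 iA wA).
have sB : (1 < size B)%N.
  by rewrite ltnNge; apply/negP => /(unit_at_size1 iB wB).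
have sE : size G = (size A + size B).-1.
  by rewrite E size_mul // -size_poly_gt0 ltnW.
have [|s [sirr Es]] := IH A _ iA wA uA; first by lia.
have [|t [tirr Et]] := IH B _ iB wB uB; first by lia.
exists (s ++ t); split; last by rewrite big_cat E Es Et.
by move=> h; rewrite mem_cat => /orP[/sirr|/tirr].
Qed.

End IntegerValued.

(** * The divisors of f and their values on W(f) *)

Section FixedDivisorKernel.
Variables (R : idomainType) (p : R) (v : R -> nat).
Hypothesis hdvr : is_dvr p v.
Variables (f : {poly R}) (k : nat) (P : 'I_k -> {poly R}) (m : 'I_k -> nat).
Hypotheses (hprim : primitive_poly f) (hP : irr_divisor_set f P).
Hypothesis hfm : f = \prod_(j < k) P j ^+ m j.
Variable n : nat.
Hypotheses (hn : vd v f n) (hn1 : (1 <= n)%N).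
Local Notation K := {fraction R}.
Local Notation mapF := (map_poly (@tofrac R)).
Local Notation PX a := (\prod_j P j ^+ a j).
Local Notation F := (Fpoly p n f).

(** A constant divisor of f divides every coefficient of f, hence 1 by primitivity, and would be a
    unit. *)
Lemma divisor_size_gt1 j : (1 < size (P j))%N.
Proof.
case: hP => /(_ j) [[Pj0 nu _] [g Eg]] _ _.
rewrite ltnNge; apply/negP => /size1_polyC E.
case: hprim => h; apply/eqP; apply: contraNneq nu => hs.
have c0 : (P j)`_0 != 0 by apply: contraNneq Pj0 => c0; rewrite E c0.
rewrite E poly_unitE size_polyC coefC c0 /=.
have Ef t : f`_t = (P j)`_0 * g`_t by rewrite Eg [in LHS]E mul_polyC coefZ.
have : dvdr (P j)`_0 1.
  rewrite -hs; apply: dvdr_sum => i _; apply: dvdr_mull.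
  by exists g`_i.
by case=> d /esym Ed; apply/unitrP; exists d; rewrite mulrC.
Qed.

Lemma divisor_irreducible_frac j : irreducible_poly (mapF (P j)).
Proof.
apply: (irr_el_irreducible_frac hdvr); last exact: divisor_size_gt1.
by case: hP => /(_ j) [].
Qed.

Lemma divisor_coprime_frac i j : i != j -> coprimep (mapF (P i)) (mapF (P j)).
Proof.
case: hP => irrP nas _ ij; apply: (irr_el_coprime_frac hdvr).
- by case: (irrP i).
- by case: (irrP j).
- exact: divisor_size_gt1.
- exact: divisor_size_gt1.
exact: nas.
Qed.

Lemma mapF_prodX (a : 'I_k -> nat) : mapF (PX a) = \prod_j mapF (P j) ^+ a j.
Proof. by rewrite rmorph_prod; apply: eq_bigr => j _; rewrite rmorphXn. Qed.

Lemma multiplicity_gt0 j : (0 < m j)%N.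
Proof.
have := prodX_irred_dvdp_leq divisor_irreducible_frac divisor_coprime_frac
  (a := fun i => (i == j) : nat) (b := m).
rewrite -!mapF_prodX -hfm => /(_ _ j); rewrite eqxx; apply.
rewrite (bigD1 j) //= eqxx big1 ?mulr1 => [|i /negPf->]; last exact: expr0.
by case: hP => /(_ j) [_ [g ->]] _ _; rewrite expr1 rmorphM dvdp_mulr.
Qed.

Lemma prodX_neq0 (a : 'I_k -> nat) : PX a != 0.
Proof.
by apply/prodf_neq0 => j _; apply: expf_neq0; case: hP => /(_ j) [[]].
Qed.

Lemma horner_prodX (a : 'I_k -> nat) r : (PX a).[r] = \prod_j (P j).[r] ^+ a j.
Proof. by rewrite horner_prod; apply: eq_bigr => j _; rewrite horner_exp. Qed.

Lemma inWf_divisor_neq0 w : f.[w] != 0 -> forall j, (P j).[w] != 0.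
Proof.
move=> fw j; apply: contraNneq fw => P0.
by rewrite hfm horner_prodX (bigD1 j) //= P0 expr0n eqn0Ngt multiplicity_gt0 mul0r.
Qed.

Lemma val_f r : (forall j, (P j).[r] != 0) ->
  v f.[r] = (\sum_j m j * v (P j).[r])%N.
Proof. by move=> P0; rewrite hfm horner_prodX (val_prodX hdvr). Qed.

Lemma val_f_ge r : (forall j, (P j).[r] != 0) ->
  (n <= \sum_j m j * v (P j).[r])%N.
Proof.
move=> P0; rewrite -val_f //; case: hn => _; apply.
by rewrite hfm horner_prodX; apply/prodf_neq0 => j _; apply: expf_neq0.
Qed.

Lemma inWf_sum w : inWf v f n w -> (\sum_j m j * v (P j).[w] = n)%N.
Proof. by case=> fw <-; rewrite val_f //; apply: inWf_divisor_neq0. Qed.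

Lemma inWf_of_sum r : (forall j, (P j).[r] != 0) ->
  (\sum_j m j * v (P j).[r] = n)%N -> inWf v f n r.
Proof.
move=> P0 <-; split; last exact: val_f.
by rewrite hfm horner_prodX; apply/prodf_neq0 => j _; apply: expf_neq0.
Qed.

(** Positive exponents make the product vanish at every root of some [P j], so the valuation bound
    is only required at the other points. *)
Lemma inInt_Fpoly_prodX E (a : 'I_k -> nat) : (forall j, 0 < a j)%N ->
  (forall r, (forall j, (P j).[r] != 0) -> (E <= \sum_j a j * v (P j).[r])%N) ->
  inInt (Fpoly p E (PX a)).
Proof.
move=> a0 h r; apply: (Fpoly_dvdr hdvr); rewrite horner_prodX.
have [/forallP P0|] := boolP [forall j, (P j).[r] != 0].
  apply/(dvdr_valP hdvr); last by rewrite (val_prodX hdvr) //; apply: h.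
  by apply/prodf_neq0 => j _; apply: expf_neq0.
rewrite negb_forall => /existsP[j]; rewrite negbK => /eqP P0.
by exists 0; rewrite (bigD1 j) //= P0 expr0n eqn0Ngt a0 mul0r mulr0.
Qed.

Lemma Fpoly_prodX_nonunit E (a : 'I_k -> nat) j : (0 < a j)%N ->
  ~ Int_unit (Fpoly p E (PX a)).
Proof.
move=> aj /Int_unit_size; rewrite (size_Fpoly hdvr) //= -size_mapF mapF_prodX.
move/eqP; rewrite size_poly_eq1 => /eqp_dvdr h.
have := h (mapF (P j)); rewrite dvdp1 (bigD1 j) //= -(prednK aj) exprS.
rewrite -mulrA dvdp_mulr // => /esym; rewrite size_mapF.
by have := divisor_size_gt1 j; lia.
Qed.

Lemma unit_at_F w : inWf v f n w -> unit_at w F.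
Proof.
move=> [fw vw]; have [e ue E] := dvr_val hdvr fw; exists e => //.
rewrite horner_Fpoly E vw mulrC rmorphM rmorphXn mulfK //.
exact: tofrac_p_neq0 hdvr _.
Qed.

Lemma unit_atX w (G : {poly K}) t : unit_at w G -> unit_at w (G ^+ t).
Proof.
by move=> [e ue E]; exists (e ^+ t); rewrite ?unitrX // horner_exp E rmorphXn.
Qed.

(** In K[x], [G] is a constant [c] times a product of powers of the [P j]. If c p^j = e p^i with [e]
    a unit, the unit value at [w] gives i + sum_t a_t v(P_t(w)) = j, so [E = j - i] is the same for
    all [w]. *)
Lemma unit_at_divisor_form N b (G H : {poly K}) :
  G * H = Fpoly p N (PX b) -> (forall w, inWf v f n w -> unit_at w G) ->
  exists a E e, [/\ e \is a GRing.unit, G = (tofrac e)%:P * Fpoly p E (PX a) &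
    forall w, inWf v f n w -> (\sum_j a j * v (P j).[w] = E)%N].
Proof.
move=> EGH uG.
have GHd : G %| \prod_j mapF (P j) ^+ b j.
  rewrite -mapF_prodX -(dvdpZr _ _ (c := (tofrac p ^+ N)^-1)).
    by rewrite -[X in _ %| X]EGH dvdp_mulr.
  by rewrite invr_eq0 (tofrac_p_neq0 hdvr).
have [a] := dvdp_prodX_irred divisor_irreducible_frac GHd.
rewrite -mapF_prodX => /eqpfP; set c := _ / _ => Ec.
have [w0 Ww0] : exists w, inWf v f n w by case: hn.
have G0 : G != 0.
  have : G * H != 0.
    by rewrite EGH -size_poly_gt0 (size_Fpoly hdvr) // size_poly_gt0 prodX_neq0.
  by apply: contraNneq => ->; rewrite mul0r.
have c0 : c != 0 by apply: contraNneq G0 => c0; rewrite Ec c0 scale0r.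
have [e [i [j [ue Ece]]]] := frac_unitX hdvr c0.
have hE w : inWf v f n w -> (i + \sum_j a j * v (P j).[w] = j)%N.
  move=> Ww; have [e' ue' Ee'] := uG w Ww.
  have P0 := inWf_divisor_neq0 Ww.1.
  have x0 : (PX a).[w] != 0.
    by rewrite horner_prodX; apply/prodf_neq0 => t _; apply: expf_neq0.
  rewrite -(val_prodX hdvr) // -horner_prodX.
  have [d ud Ed] := dvr_val hdvr x0.
  apply: (unitX_inj hdvr (e := e * d) (e' := e')) => //; first by rewrite unitrM ue.
  apply: (@tofrac_inj R); transitivity (c * tofrac p ^+ j * tofrac (PX a).[w]).
    rewrite Ece -rmorphXn -!rmorphM; congr tofrac.
    by rewrite [in RHS]Ed exprD mulrACA.
  by rewrite [RHS]rmorphM /= -Ee' Ec hornerZ horner_map rmorphXn mulrAC.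
exists a, (j - i)%N, e; split=> //; last by move=> w /hE; lia.
have ij : (i <= j)%N by have := hE _ Ww0; lia.
rewrite mul_polyC /Fpoly scalerA Ec; congr (_ *: _).
apply: (mulIf (tofrac_p_neq0 hdvr j)); rewrite Ece -{2}(subnK ij) exprD mulrA.
by rewrite mulfVK // (tofrac_p_neq0 hdvr).
Qed.

(** * Consequences of the irreducibility of F *)

Hypothesis hirr : Int_irr F.

(* Euclidean division by m: a remainder b with 0 < b < m would split F. *)
Lemma proportional_exponents (a : 'I_k -> nat) (E : nat) :
  (forall j, n * a j = E * m j)%N ->
  (n %| E)%N /\ forall j, a j = (E %/ n * m j)%N.
Proof.
move=> prop; have E_eq := divn_eq E n; set t := (E %/ n)%N in E_eq *.
set d := (E %% n)%N in E_eq; have dn : (d < n)%N by rewrite ltn_mod.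
pose b j := (a j - t * m j)%N.
have prop' j : (n * a j = n * (t * m j) + d * m j)%N.
  by rewrite prop E_eq mulnDl mulnA [(n * t)%N]mulnC.
have le_ta j : (t * m j <= a j)%N.
  by rewrite -(leq_pmul2l hn1) prop' leq_addr.
have nb j : (n * b j = d * m j)%N by rewrite mulnBr prop' addKn.
have [d0|d_gt0] := posnP d.
  split=> [|j]; first by rewrite /dvdn -/d d0.
  by have := nb j; rewrite d0 mul0n; have := le_ta j; rewrite /b; nia.
have b_gt0 j : (0 < b j)%N.
  by have := nb j; have := multiplicity_gt0 j; nia.
have nmb j : (n * (m j - b j) = (n - d) * m j)%N by rewrite mulnBr nb mulnBl.
have mb_gt0 j : (0 < m j - b j)%N.
  by have := nmb j; have := multiplicity_gt0 j; nia.
(* If n c = x m, then n times the valuation of the product is x v(f(r)), which is at least x n. *)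
have bnd (c : 'I_k -> nat) x : (forall j, n * c j = x * m j)%N ->
    forall r, (forall j, (P j).[r] != 0) -> (x <= \sum_j c j * v (P j).[r])%N.
  move=> nc r P0; rewrite -(leq_pmul2l hn1) big_distrr /=.
  rewrite (eq_bigr (fun j => x * (m j * v (P j).[r]))%N); last first.
    by move=> j _; rewrite mulnA nc mulnA.
  by rewrite -big_distrr /= mulnC leq_mul2l val_f_ge ?orbT.
have EF : F = Fpoly p d (PX b) * Fpoly p (n - d) (PX (fun j => m j - b j)%N).
  rewrite FpolyM subnKC ?(ltnW dn) // hfm; congr Fpoly.
  rewrite -big_split; apply: eq_bigr => j _ /=.
  by rewrite -exprD subnKC //; have := mb_gt0 j; lia.
(* An empty index set would give n = 0. *)
have j0 : 'I_k.
  case: (posnP k) => [k0|kgt]; last exact: Ordinal kgt.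
  exfalso; case: hn => -[w Ww] _; have := inWf_sum Ww.
  by rewrite big1 => [|j]; [move=> n0; move: hn1; rewrite -n0 | have := ltn_ord j; lia].
case: hirr => _ _ _ /(_ _ _ _ _ EF) [||u|u].
- exact: inInt_Fpoly_prodX (bnd _ _ nb).
- exact: inInt_Fpoly_prodX (bnd _ _ nmb).
- by case: (Fpoly_prodX_nonunit (b_gt0 j0) u).
- by case: (@Fpoly_prodX_nonunit _ (fun j => m j - b j)%N j0 (mb_gt0 j0) u).
Qed.

Lemma F_nonunit : ~ Int_unit F. Proof. by case: hirr. Qed.

(* With T = (n+1)B, the polynomials prod P^(m (T +- (y1 - y2))) / p^(T n) are
   integer-valued: on W(f) the perturbation vanishes, and elsewhere
   v(f(r)) >= n + 1 leaves enough room.  Their product is F^(2T). *)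
Lemma kernel_not_factors_uniquely (y1 y2 : 'I_k -> nat) B :
  (forall j, y1 j <= B)%N -> (forall j, y2 j <= B)%N ->
  (exists j, y1 j != y2 j) ->
  (forall w, inWf v f n w ->
    (\sum_j m j * v (P j).[w] * y1 j = \sum_j m j * v (P j).[w] * y2 j)%N) ->
  ~ Int_factors_uniquely (F ^+ (2 * (n + 1) * B)).
Proof.
move=> y1B y2B [j0 y12] yW uniqF; pose T := ((n + 1) * B)%N.
have B0 : (0 < B)%N by have := y1B j0; have := y2B j0; move: y12; lia.
(* This keeps every exponent [m j * (T + y j - y' j)] positive and its subtraction exact. *)
have BT : (B < T)%N by rewrite /T; nia.
pose ex (y y' : 'I_k -> nat) j := (m j * (T + y j - y' j))%N.
pose G y y' := Fpoly p (T * n) (PX (ex y y')).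
have ex_gt0 (y y' : 'I_k -> nat) j : (y' j <= B)%N -> (0 < ex y y' j)%N.
  by move=> y'B; rewrite muln_gt0 multiplicity_gt0 /=; lia.
have iG (y y' : 'I_k -> nat) : (forall j, y j <= B)%N -> (forall j, y' j <= B)%N ->
    (forall w, inWf v f n w ->
      (\sum_j m j * v (P j).[w] * y j = \sum_j m j * v (P j).[w] * y' j)%N) ->
    inInt (G y y').
  move=> yB y'B yy'; apply: inInt_Fpoly_prodX => [j|r P0]; first exact: ex_gt0.
  have hsum : (\sum_j ex y y' j * v (P j).[r] + \sum_j m j * v (P j).[r] * y' j =
      T * (\sum_j m j * v (P j).[r]) + \sum_j m j * v (P j).[r] * y j)%N.
    rewrite big_distrr -!big_split /=; apply: eq_bigr => j _; rewrite /ex.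
    have : (T + y j - y' j + y' j = T + y j)%N by have := y'B j; lia.
    by move: (T + y j - y' j)%N => z; nia.
  have [Xn|Xn] := eqVneq (\sum_j m j * v (P j).[r])%N n.
    by have := yy' r (inWf_of_sum P0 Xn); move: hsum; rewrite Xn; lia.
  (* Off W(f), with X = v(f(r)), the valuation is at least (T - B) X = nBX >= n(n+1)B = Tn. *)
  have X_gt : (n + 1 <= \sum_j m j * v (P j).[r])%N.
    by have := val_f_ge P0; move: Xn; lia.
  have y'X : (\sum_j m j * v (P j).[r] * y' j <= (\sum_j m j * v (P j).[r]) * B)%N.
    by rewrite big_distrl /=; apply: leq_sum => j _; rewrite leq_mul2l y'B orbT.
  move: hsum X_gt y'X; rewrite /T.
  move: (\sum_j m j * v (P j).[r])%N (\sum_j ex y y' j * v (P j).[r])%N.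
  move: (\sum_j _)%N (\sum_j _)%N => a b X c; nia.
have EG : G y1 y2 * G y2 y1 = F ^+ (2 * (n + 1) * B).
  rewrite FpolyM FpolyX; congr Fpoly; first by rewrite /T; ring.
  rewrite [in RHS]hfm -prodrXl -big_split; apply: eq_bigr => j _ /=.
  rewrite -exprD -exprM /ex -mulnDr; congr (_ ^+ (_ * _)).
  by have := y1B j; have := y2B j; move: BT; rewrite -mulnA -/T; lia.
have iG1 := iG y1 y2 y1B y2B yW.
have iG2 := iG y2 y1 y2B y1B (fun w Ww => esym (yW w Ww)).
have [w Ww] : exists w, inWf v f n w by case: hn.
have [uG1 uG2] : unit_at w (G y1 y2) /\ unit_at w (G y2 y1).
  by apply: unit_atM => //; rewrite EG; apply/unit_atX/unit_at_F.
have nu1 := @Fpoly_prodX_nonunit (T * n) (ex y1 y2) j0 (ex_gt0 y1 y2 j0 (y2B j0)).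
have nu2 := @Fpoly_prodX_nonunit (T * n) (ex y2 y1) j0 (ex_gt0 y2 y1 j0 (y1B j0)).
have [s1 [s1irr Es1]] := unit_at_factorization iG1 uG1 nu1.
have [s2 [s2irr Es2]] := unit_at_factorization iG2 uG2 nu2.
have fs : Int_factorization (F ^+ (2 * (n + 1) * B)) (s1 ++ s2).
  split; last by rewrite big_cat -Es1 -Es2.
  by move=> h; rewrite mem_cat => /orP[/s1irr|/s2irr].
have ft : Int_factorization (F ^+ (2 * (n + 1) * B)) (nseq (2 * (n + 1) * B) F).
  by split; [move=> h /nseqP[-> _] | rewrite big_nseq iter_mulr_1].
have [sz [sigma assoc_s]] := uniqF _ _ fs ft.
(* Comparison with the factorization into copies of F makes every factor of [G y1 y2] a constant
   multiple of F, so [G y1 y2] is one of a power of F. *)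
have s1F h : h \in s1 -> h %= F.
  move=> hs; have hs' : h \in s1 ++ s2 by rewrite mem_cat hs.
  have hi : (index h (s1 ++ s2) < size (s1 ++ s2))%N by rewrite index_mem.
  have [e /Int_unit_size se] := assoc_s (Ordinal hi).
  have lt : (sigma (Ordinal hi) < 2 * (n + 1) * B)%N.
    by apply: leq_trans (ltn_ord _) _; rewrite sz size_nseq.
  rewrite nth_index // nth_nseq lt => ->; have /eqP/size_poly1P[c c0 ->] := se.
  by rewrite mul_polyC eqp_scale.
have G1F : G y1 y2 %= F ^+ size s1.
  rewrite [G _ _]Es1; elim: s1 s1F {s1irr Es1 fs sz sigma assoc_s} => [|h s IH] sF.
    by rewrite big_nil expr0 eqpxx.
  rewrite big_cons exprS; apply: (@eqp_trans _ (F * \prod_(g <- s) g)).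
    by apply/eqp_mulr/sF; rewrite mem_head.
  by apply/eqp_mull/IH => g gs; apply: sF; rewrite inE gs orbT.
set t := size s1 in G1F.
have : mapF (PX (ex y1 y2)) %= mapF (PX (fun j => m j * t)%N).
  have c0 i : (tofrac p ^+ i)^-1 != 0 :> K by rewrite invr_eq0 (tofrac_p_neq0 hdvr).
  have -> : PX (fun j => m j * t)%N = f ^+ t.
    by rewrite hfm -prodrXl; apply: eq_bigr => j _; rewrite exprM.
  apply: eqp_trans (eqp_trans G1F _); first by rewrite eqp_sym eqp_scale.
  by rewrite FpolyX eqp_scale.
rewrite !mapF_prodX => /andP[le1 le2].
have yt j : (T + y1 j = t + y2 j)%N.
  have := prodX_irred_dvdp_leq divisor_irreducible_frac divisor_coprime_frac le1 j.
  have := prodX_irred_dvdp_leq divisor_irreducible_frac divisor_coprime_frac le2 j.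
  by rewrite !leq_pmul2l ?multiplicity_gt0 //; have := y2B j; lia.
(* Weighting by the row of a point [w] of W(f), where [y1] and [y2] have equal sums, leaves T n = t
   n. Then [y1 = y2], a contradiction. *)
have Tt : T = t.
  have : (\sum_j m j * v (P j).[w] * (T + y1 j) =
          \sum_j m j * v (P j).[w] * (t + y2 j))%N.
    by apply: eq_bigr => j _; rewrite yt.
  under eq_bigr do rewrite mulnDr; under [RHS]eq_bigr do rewrite mulnDr.
  rewrite !big_split /= yW // => /addIn; rewrite -!big_distrl /= inWf_sum //.
  by move/eqP; rewrite eqn_pmul2l // => /eqP.
by have := yt j0; move: y12; rewrite Tt; lia.
Qed.

(** * Absolute irreducibility when the kernel is zero *)

Hypothesis fdk0 : forall x : 'cV[rat]_k, fdk v f n P x -> x = 0.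

(** The exponents of [G] are proportional to [m], so [G] is a unit times a power of F;
    irreducibility of [G] leaves only the first power. *)
Lemma irr_factor_assoc t (G H : {poly K}) : Int_irr G -> G * H = F ^+ t ->
  inInt H -> Int_assoc G F.
Proof.
move=> irrG EGH iH; have [iG G0 nuG splitG] := irrG.
have uG w : inWf v f n w -> unit_at w G.
  move=> Ww; have : unit_at w (G * H) by rewrite EGH; apply/unit_atX/unit_at_F.
  by case/unit_atM.
have EGH' : G * H = Fpoly p (t * n) (PX (fun j => m j * t)%N).
  rewrite EGH FpolyX {1}hfm -prodrXl; congr Fpoly.
  by apply: eq_bigr => j _; rewrite exprM.
have [a [E [e [ue EG hE]]]] := unit_at_divisor_form EGH' uG.
have prop j : (n * a j = E * m j)%N.
  (* The vector n a - E m lies in fdk(f), since at each point of W(f) the two terms sum to nE and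
     En. *)
  pose x : 'cV[rat]_k := \col_j ((n * a j)%:R - (E * m j)%:R).
  have x0 : x = 0.
    apply: fdk0 => w Ww; rewrite (eq_bigr (fun j =>
       n%:R * (a j * v (P j).[w])%:R - E%:R * (m j * v (P j).[w])%:R)).
      rewrite sumrB -!mulr_sumr -!natr_sum hE // inWf_sum // mulrC subrr //.
    by move=> i _; rewrite mxE !natrM; ring.
  have := congr1 (fun y : 'cV[rat]_k => y j 0) x0; rewrite !mxE => /eqP.
  by rewrite subr_eq0 eqr_nat => /eqP.
have [/dvdnP[t' Et'] at'] := proportional_exponents prop.
have GF : G = (tofrac e)%:P * F ^+ t'.
  rewrite EG FpolyX -Et'; congr (_ * Fpoly _ _ _).
  rewrite {1}hfm -prodrXl; apply: eq_bigr => j _.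
  by rewrite at' Et' mulnK // mulnC exprM.
case: t' GF {Et'} => [|[|t']] GF.
- by case: nuG; rewrite GF expr0 mulr1; apply: Int_unit_tofracC.
- by exists (tofrac e)%:P; rewrite // ?expr1 //; apply: Int_unit_tofracC.
have iF : inInt F by case: hirr.
have := splitG ((tofrac e)%:P * F) (F ^+ t'.+1).
rewrite -mulrA -exprS => /(_ _ _ GF) [||u|u].
- by apply: inIntM => //; apply: inInt_tofracC.
- exact: inIntX.
- case: F_nonunit; suff -> : F = (tofrac e^-1)%:P * ((tofrac e)%:P * F).
    by apply: Int_unitM => //; apply: Int_unit_tofracC; rewrite unitrV.
  by rewrite mulrA -polyCM -rmorphM mulVr // rmorph1 mul1r.
(* If a positive power of F is a unit, then F is constant, and its unit value on W(f) makes it a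
   unit of Int(R). *)
case: u => _ u _; have : F \is a GRing.unit by rewrite -(unitrX_pos _ (ltn0Sn t')).
move=> uF; case: F_nonunit; case: hn => -[w Ww] _.
apply: (unit_at_size1 iF (unit_at_F Ww)).
by move: uF; rewrite poly_unitE => /andP[/eqP->].
Qed.

Lemma fdk0_abs_irr : Int_abs_irr F.
Proof.
split=> // j _.
have iF : inInt F by case: hirr.
have all_assoc s : Int_factorization (F ^+ j) s -> forall h, h \in s -> Int_assoc h F.
  move=> [sirr Es] h hs; have := Es; rewrite (perm_big _ (perm_to_rem hs)) big_cons /=.
  move=> /esym Eh; apply: (irr_factor_assoc (sirr h hs) Eh).
  have : {subset rem h s <= s} by apply: mem_rem.
  elim: (rem h s) => [|g r IH] sub; first by rewrite big_nil; apply: inInt1.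
  rewrite big_cons; apply: inIntM.
    by case: (sirr g) => //; apply: sub; rewrite inE eqxx.
  by apply: IH => g' g'r; apply: sub; rewrite inE g'r orbT.
have [w Ww] : exists w, inWf v f n w by case: hn.
have F0 : F != 0 by case: hirr.
have szF : (1 < size F)%N.
  by rewrite ltnNge; apply/negP => /(unit_at_size1 iF (unit_at_F Ww))/F_nonunit.
(* All factors have the degree of F, which is positive, so degrees count them. *)
have size_s s : Int_factorization (F ^+ j) s -> size s = j.
  move=> fs; have := all_assoc s fs; have [_ Es] := fs.
  move=> aF; have : (size (\prod_(h <- s) h)).-1 = ((size F).-1 * size s)%N.
    elim: s aF {fs Es} => [|h s IH] aF; first by rewrite big_nil size_poly1 muln0.
    have [e /Int_unit_size se Eh] := aF h (mem_head _ _).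
    have e0 : e != 0 by rewrite -size_poly_gt0 se.
    have sh : size h = size F by rewrite Eh size_mul // se.
    have aF' h' : h' \in s -> Int_assoc h' F.
      by move=> h's; apply: aF; rewrite inE h's orbT.
    have s0 : \prod_(h' <- s) h' != 0.
      elim: s aF' {aF IH} => [|g s IH] aF; first by rewrite big_nil oner_eq0.
      rewrite big_cons mulf_neq0 //.
        have [e' /Int_unit_size se' ->] := aF g (mem_head _ _).
        by rewrite mulf_neq0 // -size_poly_gt0 se'.
      by apply: IH => g' g's; apply: aF; rewrite inE g's orbT.
    rewrite big_cons size_mul //; last by rewrite -size_poly_gt0 sh ltnW.
    rewrite sh [size (h :: s)]/= mulnS -(IH aF'); move: szF s0.
    rewrite -size_poly_gt0; case: (size F) => [//|a] _.
    by case: (size _) => [//|b] _; rewrite addSn addnS.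
  rewrite -Es size_exp => /eqP; rewrite eqn_pmul2l; last first.
    by move: szF; case: (size F) => [|[]].
  by move/eqP.
move=> s t fs ft; split; first by rewrite (size_s s) // (size_s t).
(* Every factor on either side is associated to F, so the identity permutation serves. *)
exists 1%g => i; rewrite perm1.
have [e1 u1 E1] := all_assoc s fs _ (mem_nth 0 (ltn_ord i)).
have it : (i < size t)%N by rewrite (size_s t) // -(size_s s).
have [e2 u2 E2] := all_assoc t ft _ (mem_nth 0 it).
exists (e1 / e2).
  apply: Int_unitM => //; case: u2 => a b c; split; rewrite ?unitrV ?invrK //.
by rewrite E1 E2 mulrA mulrVK //; case: u2.
Qed.

End FixedDivisorKernel.

(** * The bound on the rank, and the equivalences *)

(** Congruent points give values with equal caps at ceil(n/2), and both weighted sums are n <= 2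
    ceil(n/2). *)
Lemma congr_inWf_val (R : idomainType) (p : R) (v : R -> nat) (f : {poly R})
    (k : nat) (P : 'I_k -> {poly R}) (m : 'I_k -> nat) (n : nat) (w w' : R) :
  is_dvr p v -> primitive_poly f -> irr_divisor_set f P ->
  f = \prod_(j < k) P j ^+ m j -> inWf v f n w -> inWf v f n w' ->
  dvdr (p ^+ uphalf n) (w - w') -> forall j, v (P j).[w] = v (P j).[w'].
Proof.
move=> hdvr hprim hP hfm Ww Ww' ww'.
apply: (@capped_eq_of_weighted_sum_eq k (uphalf n) n m).
- by rewrite -[X in (X <= _)%N]odd_double_half uphalf_half doubleD; case: odd; lia.
- exact: (multiplicity_gt0 hdvr hprim hP hfm).
- exact: (inWf_sum hdvr hprim hP hfm Ww).
- exact: (inWf_sum hdvr hprim hP hfm Ww').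
move=> j; apply: (minn_val_congr hdvr).
- exact: (inWf_divisor_neq0 hdvr hprim hP hfm Ww.1).
- exact: (inWf_divisor_neq0 hdvr hprim hP hfm Ww'.1).
exact: horner_dvdr_sub.
Qed.

Lemma row_free_row_inj (K : fieldType) (l k : nat) (A : 'M[K]_(l, k)) :
  row_free A -> forall i i', (forall j, A i j = A i' j) -> i = i'.
Proof.
move=> /row_free_inj Ainj i i' Aii'.
have : (delta_mx 0 i : 'rV[K]_l) = delta_mx 0 i'.
  by apply: Ainj; rewrite -!rowE; apply/rowP => j; rewrite !mxE.
move/rowP/(_ i); rewrite !mxE !eqxx /= => /eqP.
by case: (eqVneq i i') => // _; rewrite oner_eq0.
Qed.

Theorem theorem3 (R : idomainType) (p : R) (v : R -> nat) (q : nat)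
  (hdvr : is_dvr p v) (hq : residue_card p q)
  (f : {poly R}) (hnc : (1 < size f)%N) (hprim : primitive_poly f)
  (k : nat) (P : 'I_k -> {poly R}) (hP : irr_divisor_set f P)
  (m : 'I_k -> nat) (hfm : f = \prod_(j < k) P j ^+ m j)
  (n : nat) (hn : vd v f n) (hn1 : (1 <= n)%N)
  (l : nat) (W : 'I_l -> R) (hWinj : injective W)
  (hW : forall i, inWf v f n (W i))
  (hfree : row_free (valmat v P W))
  (hker : forall x : 'cV[rat]_k, valmat v P W *m x = 0 <-> fdk v f n P x)
  (hirr : Int_irr (Fpoly p n f)) :
  let F := Fpoly p n f in
  let A := valmat v P W in
  let u := single_rows A in
  let S1 := (2 * (n + 1) * n ^ (q ^ uphalf n))%N in
  let S2 := (2 * (n + 1) * n ^ (\rank A - u))%N in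
  (Int_abs_irr F <-> Int_factors_uniquely (F ^+ S1)) /\
  (Int_abs_irr F <-> Int_factors_uniquely (F ^+ S2)).
Proof.
move=> F A u S1 S2.
have m0 := multiplicity_gt0 hdvr hprim hP hfm.
have rkA : \rank A = l by apply/eqP.
(* Distinct rows lie over distinct residue classes modulo p^(ceil(n/2)), since independent rows are
   pairwise different. *)
have l_le : (l <= q ^ uphalf n)%N.
  have [s [sz cov]] := residue_mod_pX hq (uphalf n).
  have ex i : exists t : 'I_(size s), dvdr (p ^+ uphalf n) (W i - s`_t).
    have [b bs hb] := cov (W i).
    have bi : (index b s < size s)%N by rewrite index_mem.
    by exists (Ordinal bi); rewrite nth_index.
  have [g hg] : exists g : 'I_l -> 'I_(size s),
      forall i, dvdr (p ^+ uphalf n) (W i - s`_(g i)) by apply: fin_all_exists ex.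
  apply: leq_trans sz; have ginj : injective g.
    move=> i i' gii'; apply: (row_free_row_inj hfree) => j.
    rewrite !mxE; congr (_%:R).
    apply: (congr_inWf_val hdvr hprim hP hfm (hW i) (hW i')).
    have := dvdrD (hg i) (dvdr_opp (hg i')); rewrite gii'; congr dvdr; ring.
  by have := leq_card g ginj; rewrite !card_ord.
(* Both exponents have the form 2(n+1)B with B at least n^(rank A - u), so one argument serves
   both. *)
suff key B : (n ^ (l - u) <= B)%N ->
    (Int_abs_irr F <-> Int_factors_uniquely (F ^+ (2 * (n + 1) * B))).
  split; apply: key; last by rewrite rkA.
  by rewrite leq_pexp2l // (leq_trans (leq_subr _ _)).
move=> leB; have B0 : (0 < B)%N by apply: leq_trans leB; rewrite expn_gt0 hn1.
split=> [[_ h]|uniqF]; first by apply: h; rewrite !muln_gt0 addn1.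
(* With at least as many independent rows as columns, [A] has full column rank and fdk(f) = 0. *)
have [lk|kl] := ltnP l k; last first.
  apply: (fdk0_abs_irr hdvr hprim hP hfm hn hn1 hirr) => x /hker Ax0.
  have full : row_full A by rewrite /row_full rkA eqn_leq kl -{1}rkA rank_leq_col.
  have [B' BA] := row_fullP full.
  by rewrite -[x]mul1mx -BA -mulmxA Ax0 mulmx0.
exfalso; pose M i j := (m j * v (P j).[W i])%N.
pose U := [set i : 'I_l | #|[set j : 'I_k | A i j != 0]| == 1%N].
have Anz i j : (A i j != 0) = (v (P j).[W i] != 0%N).
  by rewrite mxE pnatr_eq0.
have [c hc] : exists c : 'I_l -> 'I_k, forall i j, i \in U -> j != c i -> M i j = 0%N.
  have k0 : (0 < k)%N by apply: leq_ltn_trans lk.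
  (* For a row in [U] this picks its unique nonzero column; the default matters only for zero rows,
     which are not in [U]. *)
  exists (fun i => odflt (Ordinal k0) [pick j | A i j != 0]) => i j.
  rewrite inE => /cards1P[j1 Aj1]; have Aj x : (A i x != 0) = (x == j1).
    by rewrite -[x == j1]in_set1 -Aj1 inE.
  case: pickP => [x|/(_ j1)]; rewrite /= Aj ?eqxx // => /eqP-> jj1.
  apply/eqP; rewrite /M muln_eq0; apply/orP; right.
  by move: jj1; rewrite -Aj Anz negbK.
have Msum i : (\sum_j M i j = n)%N by apply: (inWf_sum hdvr hprim hP hfm (hW i)).
have [y1 [y2 [y1B y2B y12 My]]] := siegel_pigeonhole hn1 lk Msum hc.
apply: (kernel_not_factors_uniquely hdvr hprim hP hfm hn hn1 hirr _ _ y12 _ uniqF).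
- by move=> j; apply: leq_trans leB.
- by move=> j; apply: leq_trans leB.
(* The pigeonhole relation holds only at the chosen points [W i]; the equality of ker A with fdk(f)
   extends it to all of W(f). *)
pose x : 'cV[rat]_k := \col_j ((m j * y1 j)%:R - (m j * y2 j)%:R).
have wsum w : \sum_j x j 0 * (v (P j).[w])%:R =
    (\sum_j m j * v (P j).[w] * y1 j)%:R - (\sum_j m j * v (P j).[w] * y2 j)%:R :> rat.
  rewrite !natr_sum -sumrB; apply: eq_bigr => j _; rewrite mxE !natrM; ring.
have /hker xfdk : A *m x = 0.
  apply/colP => i; rewrite [LHS]mxE [RHS]mxE.
  under eq_bigr => j _ do rewrite [A i j]mxE mulrC.
  by rewrite wsum (My i) subrr.
move=> w Ww; apply/eqP; rewrite -(eqr_nat rat) -subr_eq0 -wsum.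
by apply/eqP/xfdk.
Qed.
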